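(* Let $m,n$ be positive integers. Then $$\frac{m}{2(m+n)}\binom{2m}{m}\binom{2n}{n}\in\mathbb{Z}.$$ In particular, for every positive integer $n$, $$\frac{6}{n+2}\binom{2n}{n},\quad \frac{30}{n+3}\binom{2n}{n},\quad \frac{140}{n+4}\binom{2n}{n},\quad \frac{630}{n+5}\binom{2n}{n}\in\mathbb{Z}.$$
   Context: $\mathbb{Z}$ denotes the set of integers. *)

(* Defs.v *)
From mathcomp Require Import all_boot all_order all_algebra.

(* Main.v *)
Require Import Defs.
From mathcomp Require Import all_boot all_order all_algebra.
From mathcomp Require Import ring lra zify.
Set Implicit Arguments.
Unset Strict Implicit.
Unset Printing Implicit Defensive.
Import Order.TTheory GRing.Theory Num.Theory.
Local Open Scope ring_scope.

(** Write c(k) for the central binomial coefficient 'C(2k, k) and f(m, n) for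
    the rational number m c(m) c(n) / (2(m + n)). The recurrence
    (k + 1) c(k + 1) = 2(2k + 1) c(k) gives
    f(m + 1, n) - f(m, n + 1) = c(m) c(n) / (n + 1), an integer multiple of the
    Catalan number c(n) / (n + 1). Since f(0, n) = 0, integrality follows by
    induction on m. The four special values are f(m, n) for m = 2, 3, 4, 5. *)

(** Both sides equal [2 * n.+1 * 'C((2 * n).+1, n)]. *)
Lemma central_bin_rec (n : nat) :
  (n.+1 * 'C(2 * n.+1, n.+1) = 2 * (2 * n).+1 * 'C(2 * n, n))%N.
Proof.
have e1 := mul_bin_diag (2 * n).+2 n.
have e2 := mul_bin_down (2 * n).+1 n.
rewrite /= in e1 e2.
have -> : (2 * n.+1 = (2 * n).+2)%N by lia.
have e3 : ((2 * n).+1 - n = n.+1)%N by lia.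
rewrite e3 in e2; nia.
Qed.

Lemma dvdn_succ_central_bin (n : nat) : (n.+1 %| 'C(2 * n, n))%N.
Proof.
have e := mul_bin_left (2 * n) n.
have e3 : (2 * n - n = n)%N by lia.
rewrite e3 in e.
(* The Catalan number as a difference: [n.+1 * 'C(2 * n, n.+1) = n * 'C(2 * n, n)]. *)
apply/dvdnP; exists ('C(2 * n, n) - 'C(2 * n, n.+1))%N.
rewrite mulnBl -(mulnC n.+1 'C(2 * n, n.+1)) e; lia.
Qed.

Lemma central_bin_quotient_int (m n : nat) :
  (m%:R / (2 * (m%:R + n%:R)) * 'C(2 * m, m)%:R * 'C(2 * n, n)%:R : rat)
    \is a Num.int.
Proof.
(* [n] stays general: the step at [n] uses the hypothesis at [n.+1]. For [m = 0] the leading factor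
   0 also covers [n = 0], where the denominator vanishes. *)
elim: m n => [|m IHm] n; first by rewrite !mul0r.
have [q cat_n] := dvdnP (dvdn_succ_central_bin n).
suff -> : (m.+1%:R / (2 * (m.+1%:R + n%:R)) * 'C(2 * m.+1, m.+1)%:R
             * 'C(2 * n, n)%:R : rat)
  = m%:R / (2 * (m%:R + n.+1%:R)) * 'C(2 * m, m)%:R * 'C(2 * n.+1, n.+1)%:R
    + ('C(2 * m, m) * q)%:R.
  by apply: rpredD; [exact: IHm | exact: rpred_nat].
have nz (k : nat) : (k%:R + 1 : rat) != 0 by rewrite natr1 pnatr_eq0.
have crec k : 'C(2 * k.+1, k.+1)%:R
    = 2 * (2 * k%:R + 1) * 'C(2 * k, k)%:R / (k%:R + 1) :> rat.
  apply: (mulIf (nz k)); rewrite divfK //.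
  have /(congr1 (fun x : nat => x%:R : rat)) := central_bin_rec k.
  by rewrite !natrM -!natr1 natrM mulrC.
rewrite !crec cat_n !natrM -!natr1.
(* The denominators of both quotients contain [m + n + 1], bracketed differently. *)
have := nz (m + n)%N; rewrite natrD => nz_mn.
field.
by rewrite !nz /= ?[_ + 1 + _]addrAC ?addrA nz_mn.
Qed.

Theorem corollary1p5 :
  (forall m n : nat, (0 < m)%N -> (0 < n)%N ->
    (m%:R / (2 * (m%:R + n%:R)) * 'C(2 * m, m)%:R * 'C(2 * n, n)%:R : rat)
      \is a Num.int) /\
  (forall n : nat, (0 < n)%N ->
    [/\ (6 / (n%:R + 2) * 'C(2 * n, n)%:R : rat) \is a Num.int,
        (30 / (n%:R + 3) * 'C(2 * n, n)%:R : rat) \is a Num.int,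
        (140 / (n%:R + 4) * 'C(2 * n, n)%:R : rat) \is a Num.int &
        (630 / (n%:R + 5) * 'C(2 * n, n)%:R : rat) \is a Num.int]).
Proof.
split=> [m n _ _|n _]; first exact: central_bin_quotient_int.
have special (m k : nat) : (0 < m)%N -> (m * 'C(2 * m, m) = 2 * k)%N ->
    (k%:R / (n%:R + m%:R) * 'C(2 * n, n)%:R : rat) \is a Num.int.
  move=> m_gt0 /(congr1 (fun x : nat => x%:R : rat)); rewrite !natrM => e.
  have := central_bin_quotient_int m n; congr (_ \is a Num.int).
  have nz : (n%:R + m%:R : rat) != 0.
    by rewrite -natrD pnatr_eq0 addn_eq0 negb_and -!lt0n m_gt0 orbT.
  congr (_ * _); apply: (mulIf nz); rewrite divfK //.
  rewrite [m%:R / _ * _]mulrAC e (addrC m%:R).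
  by field.
(* Here [m] is 2, 3, 4, 5, with [m * 'C(2 * m, m)] equal to 12, 60, 280, 1260, twice the
   numerators. *)
by split; apply: special.
Qed.
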